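(* Assume NCF (Near Coherence of Filters): every two nonprincipal ultrafilters on $\omega$ nearly cohere. Then the continuum $\mathbb H^*$ has no coastal points and no non-block points.
   Context: A continuum is a compact connected Hausdorff space. A semicontinuum is a space $T$ such that any two points $a,b\in T$ lie in some continuum $K\subset T$. The continuum components of a Hausdorff space are its maximal continuumwise connected subspaces (maximal semicontinua). For a continuum $X$ and distinct $x,p\in X$, $\kappa(x;p)$ denotes the continuum component of $x$ in $X-p$. The point $x\in X$ is coastal if $\kappa(x;p)$ is dense in $X$ for some $p\in X$ (equivalently, $x$ lies in a dense proper semicontinuum of $X$). The point $p\in X$ is a non-block point if $\kappa(x;p)$ is dense in $X$ for some $x\in X$. $\mathbb H=\{x\in\mathbb R:x\ge0\}$ and $\mathbb H^*$ is its Stone–Čech remainder $\beta\mathbb H\setminus\mathbb H$. For $g\colon\omega\to\omega$ and an ultrafilter $\mathcal D$ on $\omega$, $g(\mathcal D)=\{E\subset\omega:g^{-1}(E)\in\mathcal D\}$. Write $\mathcal E\le\mathcal D$ if $\mathcal E=f(\mathcal D)$ for some monotone finite-to-one $f\colon\omega\to\omega$. Two nonprincipal ultrafilters nearly cohere if they have a common lower bound with respect to $\le$ among nonprincipal ultrafilters. *)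

(* Defs.v *)
From mathcomp Require Import all_boot all_order all_algebra.
From mathcomp Require Import all_classical all_reals all_analysis.
Set Implicit Arguments.
Unset Strict Implicit.
Unset Printing Implicit Defensive.
Import Order.TTheory GRing.Theory Num.Theory.
Import numFieldNormedType.Exports.

Local Open Scope classical_set_scope.
Local Open Scope ring_scope.

(* Throughout, a subset [A] of a topological space, seen as a space in its own
   right, is [set_type A] with the initial topology of the inclusion. *)

Definition continuum (T : topologicalType) (K : set T) : Prop :=
  [/\ compact K, connected K & hausdorff_space (set_type K)].

Definition semicontinuum (T : topologicalType) (S : set T) : Prop :=
  forall a b, S a -> S b ->
    exists K : set T, [/\ continuum K, K `<=` S, K a & K b].

(* As for [connected_component], the maximal semicontinuum of [A] at [x] is given
   as a union; in a Hausdorff space it is indeed a semicontinuum and maximal, by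
   [semicontinuum_continuum_component] and [continuum_component_maximal]. *)
Definition continuum_component (T : topologicalType) (A : set T) (x : T) :
    set T :=
  \bigcup_(S in [set S | [/\ S x, S `<=` A & semicontinuum S]]) S.

Definition kappa (X : topologicalType) (x p : X) : set X :=
  continuum_component (~` [set p]) x.

Definition coastal (X : topologicalType) (x : X) : Prop :=
  exists p : X, x <> p /\ dense (kappa x p).

Definition non_block_point (X : topologicalType) (p : X) : Prop :=
  exists x : X, x <> p /\ dense (kappa x p).

(* Cech's construction: the closure of the image of [X] in the cube indexed by
   all the continuous functions from [X] to [0, 1]. Its universal property is
   [stone_cech_extension] below. *)
Definition unit_functions (R : realType) (X : topologicalType) : set (X -> R) :=
  [set f : X -> R | continuous f /\ range f `<=` `[0, 1]].

Definition cube (R : realType) (X : topologicalType) : topologicalType :=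
  {ptws set_type (@unit_functions R X) -> R}.

Definition cube_eval (R : realType) (X : topologicalType) : X -> cube R X :=
  join_product (fun f : set_type (@unit_functions R X) => set_val f : X -> R).
Arguments cube_eval R {X} x.

Definition stone_cech (R : realType) (X : topologicalType) : topologicalType :=
  set_type (closure (range (@cube_eval R X))).

Definition stone_cech_embed (R : realType) (X : topologicalType) (x : X) :
    stone_cech R X :=
  exist _ (cube_eval R x)
    (mem_set (@subset_closure _ (range (@cube_eval R X)) _ (imageT _ x))).
Arguments stone_cech_embed R {X} x.

Definition stone_cech_remainder (R : realType) (X : topologicalType) :
    topologicalType :=
  set_type (~` range (@stone_cech_embed R X)).

Definition half_line (R : realType) : topologicalType :=
  set_type [set x : R | 0 <= x].

Definition half_line_remainder (R : realType) : topologicalType :=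
  stone_cech_remainder R (half_line R).

Definition nonprincipal_ultrafilter (D : set_system nat) : Prop :=
  UltraFilter D /\ forall n : nat, D <> principal_filter n.

Definition finite_to_one (f : nat -> nat) : Prop :=
  forall n, finite_set (f @^-1` [set n]).

(* [fmap f D] is the filter f(D) of all the E such that D contains the preimage
   of E. "Monotone" means nondecreasing: a nonincreasing function on nat is
   eventually constant, hence not finite-to-one. *)
Definition ultrafilter_le (E D : set_system nat) : Prop :=
  exists f : nat -> nat,
    [/\ {homo f : m n / (m <= n)%N}, finite_to_one f & E = fmap f D].

Definition nearly_cohere (D E : set_system nat) : Prop :=
  exists F : set_system nat,
    [/\ nonprincipal_ultrafilter F, ultrafilter_le F D & ultrafilter_le F E].

Definition near_coherence_of_filters : Prop :=
  forall D E : set_system nat,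
    nonprincipal_ultrafilter D -> nonprincipal_ultrafilter E ->
    nearly_cohere D E.

Lemma set_type_hausdorff (T : topologicalType) (A : set T) :
  hausdorff_space T -> hausdorff_space (set_type A).
Proof.
move=> hT p q clpq; apply/val_inj/hT => U V Up Vq.
have cts : continuous (set_val : set_type A -> T) by exact: initial_continuous.
have [z [Uz Vz]] := clpq _ _ (cts p _ Up) (cts q _ Vq).
by exists (set_val z).
Qed.

Lemma set_type_compact (T : topologicalType) (A : set T) :
  compact A -> compact [set: set_type A].
Proof.
move=> cA F FF _.
have FA : F (set_val @^-1` A) by apply: filterS filterT => z _; exact: set_valP.
have [a [Aa cla]] := cA _ (fmap_proper_filter (set_val : set_type A -> T) FF) FA.
exists (exist _ a (mem_set Aa)); split => // U V FU [W [[B oB <-] /= Ba BV]].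
have FsU : F (set_val @^-1` (set_val @` U)).
  by apply: filterS FU => u Uu; exists u.
have [_ [[u Uu <-] Bu]] := cla _ _ FsU (open_nbhs_nbhs (conj oB Ba)).
by exists u; split => //; exact: BV.
Qed.

Lemma continuum_setU (T : topologicalType) (K L : set T) :
  hausdorff_space T -> K `&` L !=set0 -> continuum K -> continuum L ->
  continuum (K `|` L).
Proof.
move=> hT KL0 [cK nK _] [cL nL _].
by split; [exact: compactU|exact: connectedU|exact: set_type_hausdorff].
Qed.

Lemma semicontinuum_continuum_component (T : topologicalType) (A : set T) x :
  hausdorff_space T -> semicontinuum (continuum_component A x).
Proof.
move=> hT a b [S [Sx SA sS] Sa] [S' [S'x S'A sS'] S'b].
have [K [cK KS Ka Kx]] := sS _ _ Sa Sx.
have [L [cL LS' Lx Lb]] := sS' _ _ S'x S'b.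
exists (K `|` L); split; [|move=> z [/KS Sz|/LS' Sz]|by left|by right].
- by apply: continuum_setU => //; exists x.
- by exists S.
- by exists S'.
Qed.

Lemma continuum_component_refl (T : topologicalType) (A : set T) x :
  hausdorff_space T -> A x -> continuum_component A x x.
Proof.
move=> hT Ax; exists [set x] => //; split => //; first by move=> _ ->.
move=> _ _ -> ->; exists [set x]; split => //; split.
- exact: compact_set1.
- exact: connected1.
- exact: set_type_hausdorff.
Qed.

Lemma continuum_component_maximal (T : topologicalType) (A S : set T) x :
  continuum_component A x `<=` S -> S `<=` A -> S x -> semicontinuum S ->
  S = continuum_component A x.
Proof. by move=> CS SA Sx sS; apply/seteqP; split => // y Sy; exists S. Qed.

Lemma cube_continuous (R : realType) (X T : topologicalType) (g : T -> cube R X) :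
  (forall f, continuous (fun t => g t f : R)) -> continuous g.
Proof.
move=> cg t; apply/cvg_sup => f U [_ [[B oB <-] Bgt BU]].
apply: (filterS BU); apply: (cg f t); exact: open_nbhs_nbhs.
Qed.

Lemma cube_proj_continuous (R : realType) (X : topologicalType)
    (f : set_type (@unit_functions R X)) :
  continuous (fun p : cube R X => p f : R).
Proof. exact: (@proj_continuous _ (fun=> R) f). Qed.

Lemma cube_hausdorff (R : realType) (X : topologicalType) :
  hausdorff_space (cube R X).
Proof. by apply: (@hausdorff_product _ (fun=> R)) => f; exact: Rhausdorff. Qed.

Lemma cube_eval_continuous (R : realType) (X : topologicalType) :
  continuous (@cube_eval R X).
Proof. by apply: cube_continuous => f; have [] := set_valP f. Qed.

Lemma compact_closure_cube_eval (R : realType) (X : topologicalType) :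
  compact (closure (range (@cube_eval R X))).
Proof.
have cC : compact [set p : cube R X | forall f, `[0, 1]%classic (p f)].
  by have := @tychonoff (set_type (@unit_functions R X)) (fun=> R)
    (fun=> `[0, 1]%classic) (fun=> @segment_compact R 0 1).
have clC := compact_closed (@cube_hausdorff R X) cC.
apply: (subclosed_compact _ cC); first exact: closed_closure.
rewrite [X in _ `<=` X](closure_id _).1//; apply: closureS.
by move=> _ [x _ <-] f; have [_] := set_valP f; apply; exists x.
Qed.

Lemma stone_cech_compact (R : realType) (X : topologicalType) :
  compact [set: stone_cech R X].
Proof. exact/set_type_compact/compact_closure_cube_eval. Qed.

Lemma stone_cech_hausdorff (R : realType) (X : topologicalType) :
  hausdorff_space (stone_cech R X).
Proof. exact/set_type_hausdorff/cube_hausdorff. Qed.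

Lemma stone_cech_embed_continuous (R : realType) (X : topologicalType) :
  continuous (@stone_cech_embed R X).
Proof.
move=> x U [_ [[B oB <-] Bx BU]].
apply: (filterS (fun y => BU (stone_cech_embed R y))).
by apply: (@cube_eval_continuous R X x); exact: open_nbhs_nbhs.
Qed.

Lemma stone_cech_embed_dense (R : realType) (X : topologicalType) :
  dense (range (@stone_cech_embed R X)).
Proof.
move=> U [[p clp] Up] [B oB BU]; rewrite -BU in Up *.
have Bp : B p by exact: Up.
have [_ [[x _ <-] Bx]] := set_mem clp _ (open_nbhs_nbhs (conj oB Bp)).
by exists (stone_cech_embed R x); split => //; exists x.
Qed.

Lemma unit_functions_separate (R : realType) (X : topologicalType) :
  completely_regular_space X ->
  separate_points_from_closed
    (fun f : set_type (@unit_functions R X) => set_val f : X -> R).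
Proof.
move=> crX U x clU nUx.
have /(@uniform_separatorP _ R)[f [cf f01 fx fU]] := crX x U clU nUx.
have fx0 : f x = 0 by apply: fx; exists x.
exists (exist _ f (mem_set (conj cf f01))); rewrite set_valE /= fx0.
move=> /(closureS fU); rewrite -(closure_id _).1.
  by move=> /esym/eqP; rewrite oner_eq0.
by apply: accessible_closed_set1; exact/hausdorff_accessible/Rhausdorff.
Qed.

Lemma cube_eval_inj (R : realType) (X : topologicalType) :
  completely_regular_space X -> hausdorff_space X -> injective (@cube_eval R X).
Proof.
move=> crX hX x y; apply: (join_product_inj (unit_functions_separate R crX)).
- exact: hausdorff_accessible.
- by rewrite inE.
- by rewrite inE.
Qed.

Lemma cube_eval_open (R : realType) (X : topologicalType) :
  completely_regular_space X -> hausdorff_space X ->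
  @open X = @open (initial_topology (@cube_eval R X)).
Proof.
move=> crX hX; apply: (join_product_initial (unit_functions_separate R crX)).
- by move=> f; have [] := set_valP f.
- by move=> x y _ _; exact: cube_eval_inj.
Qed.

Lemma stone_cech_embed_inj (R : realType) (X : topologicalType) :
  completely_regular_space X -> hausdorff_space X ->
  injective (@stone_cech_embed R X).
Proof. by move=> crX hX x y /(congr1 set_val); exact: cube_eval_inj. Qed.

Lemma stone_cech_embed_open (R : realType) (X : topologicalType) :
  completely_regular_space X -> hausdorff_space X ->
  @open X = @open (initial_topology (@stone_cech_embed R X)).
Proof.
move=> crX hX; rewrite (cube_eval_open R crX hX).
apply/seteqP; split => U [V oV <-].
  by exists (set_val @^-1` V) => //; exists V.
by case: oV => B oB <-; exists B.
Qed.

Lemma stone_cech_extension (R : realType) (X K : topologicalType) (g : X -> K) :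
  compact [set: K] -> hausdorff_space K -> continuous g ->
  exists2 G : stone_cech R X -> K, continuous G &
    G \o @stone_cech_embed R X = g.
Proof.
move=> cK hK cg.
have crK : completely_regular_space K.
  apply: (@normal_completely_regular R); last exact: hausdorff_accessible.
  exact: compact_normal.
have pull01 (f : set_type (@unit_functions R K)) :
    (set_val f \o g) \in @unit_functions R X.
  have [cf f01] := set_valP f; rewrite inE; split.
    by move=> x; apply: continuous_comp; [exact: cg|exact: cf].
  by move=> _ [x _ <-]; apply: f01; exists (g x).
pose pull (p : cube R X) : cube R K :=
  fun f => p (SigSub (pull01 f) : set_type (@unit_functions R X)).
have pull_cts : continuous pull.
  by apply: cube_continuous => f; exact: cube_proj_continuous.
have clK : closed (range (@cube_eval R K)).
  apply: compact_closed; first exact: cube_hausdorff.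
  apply: continuous_compact cK.
  by apply: continuous_subspaceT; exact: cube_eval_continuous.
have rG (b : stone_cech R X) : exists y : K, cube_eval R y = pull (set_val b).
  suff [y _ yb] : range (@cube_eval R K) (pull (set_val b)) by exists y.
  apply: clK => U /pull_cts Ub; have [_ [[x _ <-] Ux]] := set_valP b _ Ub.
  by exists (cube_eval R (g x)); split => //; exists (g x).
pose G b := projT1 (cid (rG b)).
have GE b : cube_eval R (G b) = pull (set_val b) := projT2 (cid (rG b)).
exists G; last first.
  by apply/funext => x; exact/(cube_eval_inj crK hK)/GE.
apply/continuousP => U; rewrite (cube_eval_open R crK hK) => -[V oV <-].
rewrite -comp_preimage (_ : _ \o G = pull \o set_val); last exact/funext.
rewrite comp_preimage; exists (pull @^-1` V) => //.
by apply: open_comp => // p _; exact: pull_cts.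
Qed.

Lemma half_line_completely_regular (R : realType) :
  completely_regular_space (half_line R).
Proof. exact: (@uniform_completely_regular _ (set_type [set x : R | 0 <= x])). Qed.

Lemma half_line_hausdorff (R : realType) : hausdorff_space (half_line R).
Proof. exact/set_type_hausdorff/Rhausdorff. Qed.

(* Main.v *)
Require Import Defs.
From mathcomp Require Import all_boot all_order all_algebra.
From mathcomp Require Import all_classical all_reals all_analysis.
From mathcomp Require Import wochoice zify lra.

(** The theorem rests on a link between the remainder of the half-line and
    sparse ultrafilters, those that contain, for each function [g], a set whose
    successive elements outgrow [g] (such ultrafilters are essentially Q-points).

    Suppose that [kappa x p] is dense. Lift [p] and [x] to ultrafilters on the
    half-line. By near coherence a suitable partition of the half-line into
    intervals I_0, I_1, ... sends both to one ultrafilter [F] on the indices. A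
    continuum [K] that contains [x] and misses [p] has a closed neighbourhood [Z]
    omitting a point of I_n for F-many [n]; these gaps cut [Z] into blocks, and
    connectedness confines [K] to the blocks selected by [x] along [F]
    ([continuum_gaps]). If moreover [K] meets the closure of a given unbounded
    set of small intervals, then F-many blocks must meet that set, so that
    between two gaps of an [F]-large set lies one of the intervals. Density allows
    the intervals to be as far apart as desired, and [F] is sparse
    ([dense_kappa_sparse]).

    It remains to see that near coherence of filters excludes sparse ultrafilters
    ([sparse_ultrafilter_not_cohere]). Given a sparse [F], an ultrafilter [E] not
    nearly coherent with [F] is built by transfinite recursion along a dominating
    family of functions of least size ([dominating_scale]). Each function codes an
    interval partition, and near coherence of [E] and [F] would be witnessed, up
    to halving the indices, by the partition of one of these functions
    ([nearly_cohere_halves]). At each stage one puts in [E] the complement of all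
    the intervals close to some member of [F]. Fewer sets than the size of the
    family have been chosen before that stage; if they left no room for the new
    one, then they would capture arbitrarily sparse members of [F], and functions
    read off from them would dominate, against minimality
    ([escape_saturation]). *)

Set Implicit Arguments.
Unset Strict Implicit.
Unset Printing Implicit Defensive.
Import Order.TTheory GRing.Theory Num.Theory.
Import numFieldNormedType.Exports.
Local Open Scope classical_set_scope.

(** * Ultrafilters on the natural numbers *)

Definition unbounded_set (A : set nat) : Prop :=
  forall N, exists2 n, A n & (N <= n)%N.

Lemma tail_nonprincipal (D : set_system nat) :
  UltraFilter D -> (forall N, D [set n | (N <= n)%N]) ->
  nonprincipal_ultrafilter D.
Proof.
move=> uD Dt; split=> // n Dn.
by have := Dt n.+1; rewrite Dn => /principal_filterP /=; rewrite ltnn.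
Qed.

Lemma fmap_ultra (S T : Type) (f : S -> T) (D : set_system S) :
  UltraFilter D -> UltraFilter (fmap f D).
Proof.
move=> uD; split=> [|G pG DG]; first exact: fmap_proper_filter.
apply/seteqP; split=> A GA; last exact: DG.
have [//|DnA] := in_ultra_setVsetC (f @^-1` A) uD.
have GnA : G (~` A) by exact: DG.
by have [t []] := filter_ex (filterI GA GnA).
Qed.

Lemma ultra_ext (T : Type) (D E : set_system T) :
  UltraFilter D -> UltraFilter E -> D `<=` E -> D = E.
Proof. by move=> uD uE DE; apply/esym; apply: max_filter. Qed.

Lemma finite_set_nat_bound (A : set nat) :
  finite_set A -> exists N, forall n, A n -> (n <= N)%N.
Proof.
move=> /finite_seqP[s ->]; exists (\max_(n <- s) n) => n /= ns.
by rewrite (big_rem n ns) /= leq_maxl.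
Qed.

(** * Interval partitions of the natural numbers *)

Lemma majorant (g : nat -> nat) :
  exists G : nat -> nat, [/\ {homo G : m n / (m <= n)%N},
    forall n, (n < G n)%N & forall n, (g n < G n)%N].
Proof.
exists (fun n => \sum_(k < n.+1) (g k).+1); split=> [m n mn|n|n].
- rewrite (big_ord_widen n.+1 (fun k => (g k).+1)) // big_mkcond leq_sum // => k _.
  by case: ifP.
- by rewrite -[X in (X <= _)%N](card_ord n.+1) -sum1_card leq_sum.
- by rewrite big_ord_recr /= leq_addl.
Qed.

(** The interval containing [n] starts at [iter (j n) G 0], where [G] majorizes
    [g] strictly: a jump of [g] reaches the next interval at most. *)
Lemma interval_partition (g : nat -> nat) :
  exists j : nat -> nat, [/\ {homo j : m n / (m <= n)%N},
    forall N, exists M, forall n, (j n <= N)%N -> (n <= M)%N &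
    forall n m, (m <= g n)%N -> (j m <= (j n).+1)%N].
Proof.
have [G [homG ltG gG]] := majorant g.
pose a k := iter k G 0%N.
have ak k : (k <= a k)%N.
  by elim: k => // k IH; rewrite (leq_ltn_trans IH)//= ltG.
have homa : {homo a : m n / (m <= n)%N}.
  apply: homo_leq => // [n k m|k]; first exact: leq_trans.
  exact: ltnW (ltG _).
have exj n : exists j, forall k, (k <= j)%N = (a k <= n)%N.
  have P0 : exists k, (a k <= n)%N by exists 0%N.
  have Pn k : (a k <= n)%N -> (k <= n)%N by exact: leq_trans (ak k).
  exists (ex_maxn P0 Pn); case: ex_maxnP => j ajn jmax k; apply/idP/idP.
    by move=> kj; exact: leq_trans (homa _ _ kj) ajn.
  exact: jmax.
have [j jP] := choice exj.
exists j; split=> [m n mn|N|n m mg].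
- by rewrite jP (leq_trans _ mn)// -jP.
- exists (a N.+1) => n jn; apply: ltnW; rewrite ltnNge -jP.
  by rewrite -ltnNge ltnS.
- rewrite leqNgt jP -ltnNge /= (leq_ltn_trans mg)// (leq_trans (gG n))//.
  by apply/homG/ltnW; rewrite ltnNge -[G _]/(a (j n).+1) -jP -ltnNge.
Qed.

(** * Near coherence *)

(** Where the common value of [f1] and [f2] lies in [V], it determines the value
    of [h]; so both images under [h] are images of [fmap f1 D = fmap f2 E]. *)
Lemma fmap_eq_on (D E : set_system nat) (f1 f2 h : nat -> nat) (V : set nat) :
  UltraFilter D -> UltraFilter E -> fmap f1 D = fmap f2 E -> fmap f1 D V ->
  (forall n m, f1 n = f2 m -> V (f1 n) -> h n = h m) ->
  fmap h D = fmap h E.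
Proof.
move=> uD uE DE DV hV.
suff sub : fmap h D `<=` fmap h E.
  exact: ultra_ext (fmap_ultra h uD) (fmap_ultra h uE) sub.
move=> A DA.
have : fmap f1 D (f1 @` (h @^-1` A `&` f1 @^-1` V)).
  have DhA : D (h @^-1` A) by [].
  have DfV : D (f1 @^-1` V) by [].
  by apply: (@filterS _ D _ _ _ _ (filterI DhA DfV)) => n nAV; exists n.
rewrite DE; apply: (@filterS _ E) => m [n [An Vn] nm] /=.
by rewrite -(hV n m).
Qed.

(** Read a value [c] as the finite block of all the [n] with [f1 n = c] or
    [f2 n = c]; then [n] lies in two blocks, which [e n] bounds. *)
Lemma common_bound (f1 f2 : nat -> nat) :
  finite_to_one f1 -> finite_to_one f2 ->
  exists e : nat -> nat, forall n m,
    [\/ f1 n = f1 m, f2 n = f2 m, f1 n = f2 m | f2 n = f1 m] -> (m <= e n)%N.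
Proof.
move=> f1f f2f.
have [b1 b1P] := choice (fun c => finite_set_nat_bound (f1f c)).
have [b2 b2P] := choice (fun c => finite_set_nat_bound (f2f c)).
exists (fun n => b1 (f1 n) + b2 (f2 n) + b1 (f2 n) + b2 (f1 n))%N => n m.
by case=> H; [have := b1P (f1 n) m (esym H)|have := b2P (f2 n) m (esym H)|
  have := b2P (f1 n) m (esym H)|have := b1P (f2 n) m (esym H)]; lia.
Qed.

(** The definition of near coherence allows different maps on the two sides;
    here one map serves both. A block of values as in [common_bound] meets at most
    two intervals of [j], and these are consecutive. They are merged either by
    halving [j] downwards or by halving it upwards, and the ultrafilter of values
    decides which of the two happens on a large set. *)
Lemma nearly_cohere_halves (D E : set_system nat) :
  UltraFilter D -> UltraFilter E -> nearly_cohere D E ->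
  exists e : nat -> nat, forall j : nat -> nat,
    (forall n m, (m <= e n)%N -> (j m <= (j n).+1)%N) ->
    fmap (fun n => (j n)./2) D = fmap (fun n => (j n)./2) E \/
    fmap (fun n => uphalf (j n)) D = fmap (fun n => uphalf (j n)) E.
Proof.
move=> uD uE [F [_ [f1 [_ f1f F1]] [f2 [_ f2f F2]]]].
have DE : fmap f1 D = fmap f2 E by rewrite -F1.
have [e eP] := common_bound f1f f2f.
exists e => j jP.
pose V : set nat := [set c | forall n m, f1 n = c -> f2 m = c -> (j n)./2 = (j m)./2].
have [DV|DnV] := in_ultra_setVsetC V (fmap_ultra f1 uD).
  by left; apply: (fmap_eq_on uD uE DE DV) => n m nm; apply.
right; apply: (fmap_eq_on uD uE DE DnV) => n m nm /existsNP[n0] /existsNP[m0].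
move=> /not_implyP[n0n] /not_implyP[m0n] jnm0.
have H a b : [\/ f1 a = f1 b, f2 a = f2 b, f1 a = f2 b | f2 a = f1 b] ->
    (j b <= (j a).+1)%N /\ (j a <= (j b).+1)%N.
  move=> ab; split; apply/jP/eP => //.
  by case: ab => ->; [apply: Or41|apply: Or42|apply: Or44|apply: Or43].
have := H n m (Or43 _ _ _ nm).
have := H n n0 (Or41 _ _ _ (esym n0n)).
have := H m m0 (Or42 _ _ _ (etrans (esym nm) (esym m0n))).
have := H n m0 (Or43 _ _ _ (esym m0n)).
have := H m n0 (Or44 _ _ _ (etrans (esym nm) (esym n0n))).
have := H n0 m0 (Or43 _ _ _ (etrans n0n (esym m0n))).
rewrite !uphalf_half; move: jnm0.
by move: (j n) (j m) (j n0) (j m0) => a b c d; lia.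
Qed.

(** * A dominating scale *)

(** Words whose letters are natural numbers or elements of [P]: the closure of
    [P] under the formation of finite sequences. Working with all the words over
    [P] replaces the fact that an infinite cardinal equals that of its finite
    subsets. *)
Definition word_over (T : eqType) (P : set T) (w : seq (nat + T)) : Prop :=
  forall x, inr x \in w -> P x.

(** There are too few words over [P] to index a family dominating everywhere;
    this plays the part of a cardinal below the dominating number. *)
Definition small_alphabet (T : eqType) (P : set T) : Prop :=
  forall phi : seq (nat + T) -> nat -> nat,
    exists e : nat -> nat, forall w, word_over P w -> exists m, (phi w m < e m)%N.

Fixpoint join_words (T : Type) (l : seq (seq (nat + T))) : seq (nat + T) :=
  if l is w :: l' then inl (size w) :: w ++ join_words l' else [::].

(** Recording the length of each word makes the concatenation decodable. *)
Lemma join_words_inj (T : Type) : injective (@join_words T).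
Proof.
elim=> [|w l IH] [|w' l'] //= [sw].
move=> /(congr1 (fun s => (take (size w) s, drop (size w) s))).
rewrite take_size_cat // drop_size_cat // sw take_size_cat // drop_size_cat //.
by case=> -> /IH ->.
Qed.

Lemma word_over_join (T : eqType) (P : set T) l :
  (forall w, w \in l -> word_over P w) -> word_over P (join_words l).
Proof.
elim: l => [|w l IH] wP x //=; rewrite inE mem_cat /= => /orP[].
  by apply: wP; rewrite mem_head.
by apply: IH => v vl; apply: wP; rewrite inE vl orbT.
Qed.

Lemma small_alphabet_sub (T : eqType) (P Q : set T) :
  P `<=` Q -> small_alphabet Q -> small_alphabet P.
Proof.
move=> PQ sQ phi; have [e eP] := sQ phi; exists e => w wP.
by apply: eP => x /wP /PQ.
Qed.

(** Words over the empty set are countably many, and a countable family is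
    surpassed by diagonal summation. *)
Lemma small_alphabet_set0 (T : eqType) : small_alphabet (@set0 T).
Proof.
move=> phi.
pose f n : nat -> nat :=
  if unpickle n is Some s then phi [seq inl i | i : nat <- s] else (fun=> 0%N).
exists (fun m => (\sum_(n < m.+1) f n m).+1) => w w0.
have [s ws] : exists s : seq nat, w = [seq inl i | i <- s].
  elim: w w0 => [|[n|x] w IH] w0; first by exists [::].
    have [x xw|s ->] := IH; last by exists (n :: s).
    by apply: (w0 x); rewrite inE xw orbT.
  by have := w0 x (mem_head _ _).
exists (pickle s); rewrite ltnS big_ord_recr /= {2}/f pickleK -ws.
exact: leq_addl.
Qed.

(** The numbers leave room to code one more letter. *)
Lemma small_alphabet_setU1 (T : eqType) (P : set T) a :
  small_alphabet P -> small_alphabet (a |` P).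
Proof.
move=> sP phi.
pose dec (c : nat + T) : nat + T :=
  match c with inl 0 => inr a | inl n.+1 => inl n | inr x => inr x end.
pose enc (c : nat + T) : nat + T :=
  match c with inl n => inl n.+1 | inr x => if x == a then inl 0%N else inr x end.
have encK : cancel enc dec by case=> [//|x] /=; case: eqVneq => [->|].
have [e eP] := sP (fun w => phi (map dec w)); exists e => w wP.
rewrite -(mapK encK w); apply: eP => x /mapP[[//|y] yw] /=.
by case: eqVneq => // ya [->]; have [/eqP|//] := wP y yw; rewrite (negPf ya).
Qed.

(** The well-ordering principle, as a strict order suited to recursion. *)
Lemma well_founded_total (T : Type) : exists lt : T -> T -> Prop,
  [/\ well_founded lt, forall x y z, lt x y -> lt y z -> lt x z,
      forall x y, [\/ lt x y, x = y | lt y x] & forall x, ~ lt x x].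
Proof.
have [R woR] := @well_ordering_principle {classic T}.
have anti : antisymmetric R.
  move=> x y; apply: (@wo_chain_antisymmetric {classic T} R predT) => // A _.
  exact: woR.
have min (A : set T) : A !=set0 -> exists2 x, A x & forall y, A y -> R x y.
  move=> [x0 Ax0]; have [|x [[xA xmin] _]] := woR (fun x => `[< A x >]).
    by exists x0; exact/asboolP.
  exists x; first exact/asboolP.
  by move=> y Ay; apply: xmin; exact/asboolP.
have tot x y : R x y \/ R y x.
  have [z [->|->] zmin] := min [set x; y] (ex_intro _ x (or_introl erefl)).
    by left; apply: zmin; right.
  by right; apply: zmin; left.
have refl x : R x x by case: (tot x x).
have tr x y z : R x y -> R y z -> R x z.
  move=> xy yz.
  have [u [[->|->]|->] umin] := min [set x; y; z] (ex_intro _ z (or_intror erefl)).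
  - by apply: umin; right.
  - have /(conj xy)/andP yx : R y x by apply: umin; left; left.
    by rewrite (anti _ _ yx).
  - have zy : R z y by apply: umin; left; right.
    by have /andP/anti <- := conj yz zy.
exists (fun x y => R x y /\ x <> y); split.
- move=> x; apply: contrapT => nx.
  have [y ny ymin] :=
    min [set x | ~ Acc (fun x y => R x y /\ x <> y) x] (ex_intro _ x nx).
  apply: ny; constructor => z [zy nzy]; apply: contrapT => nz.
  by apply: nzy; have /andP/anti := conj zy (ymin z nz).
- move=> x y z [xy nxy] [yz nyz]; split; first exact: tr xy yz.
  by move=> xz; apply: nxy; rewrite -xz in yz; have /andP/anti := conj xy yz.
- move=> x y; have [->|nxy] := pselect (x = y); first exact: Or32.
  have [xy|yx] := tot x y; first exact: Or31.
  by apply: Or33; split=> // /esym.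
- by move=> x [].
Qed.

Lemma well_founded_min (T : Type) (lt : T -> T -> Prop) (A : set T) :
  well_founded lt -> A !=set0 -> exists2 x, A x & forall y, A y -> ~ lt y x.
Proof.
move=> wf [x Ax]; elim/(well_founded_ind wf) : x Ax => x IH Ax.
have [H|/existsNP[y /not_implyP[Ay /contrapT yx]]] :=
  pselect (forall y, A y -> ~ lt y x); first by exists x.
exact: IH yx Ay.
Qed.

Lemma seq_last_lt (I : eqType) (lt : I -> I -> Prop) x (l : seq I) :
  (forall i j k, lt i j -> lt j k -> lt i k) ->
  (forall i j, [\/ lt i j, i = j | lt j i]) ->
  exists2 k, k \in x :: l & forall k', k' \in x :: l -> k' <> k -> lt k' k.
Proof.
move=> tr tot; elim: l => [|y l [k kl kmax]].
  by exists x; [exact: mem_head|move=> k; rewrite inE => /eqP].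
have sub z : (z \in x :: y :: l) = (z == y) || (z \in x :: l).
  by rewrite !inE orbCA.
have [ky|ky|yk] := tot k y.
- exists y; first by rewrite sub eqxx.
  move=> z; rewrite sub => /orP[/eqP//|zl _].
  by have [->//|zk] := eqVneq z k; apply: (tr _ k) => //; exact/kmax/eqP.
- exists k; first by rewrite sub kl orbT.
  by move=> z; rewrite sub -ky => /orP[/eqP//|]; exact: kmax.
- exists k; first by rewrite sub kl orbT.
  by move=> z; rewrite sub => /orP[/eqP->//|]; exact: kmax.
Qed.

(** A well-ordered dominating family of least size. Well-order all the functions
    and let [A] consist of those whose initial segment is a small alphabet. Then
    [A] is not small: otherwise the least function outside [A] could be added to
    it. So some family indexed by the words over [A] is dominating. These words are
    ordered first by the least bound in [A] of their letters, so that the words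
    before a given one, and the finite sequences of such words, are coded by words
    over a single small alphabet. *)
Lemma dominating_scale :
  exists (I : eqType) (lt : I -> I -> Prop) (g : I -> nat -> nat),
  [/\ well_founded lt,
      forall i j k, lt i j -> lt j k -> lt i k,
      forall i j, [\/ lt i j, i = j | lt j i],
      forall e : nat -> nat, exists i, forall n, (e n <= g i n)%N &
      forall i (phi : nat * seq I -> nat -> nat), exists e : nat -> nat,
        forall n l, (forall j, j \in l -> lt j i) ->
          exists m, (phi (n, l) m < e m)%N].
Proof.
pose T : eqType := {classic (nat -> nat)}.
have [ltT [wfT trT totT irrT]] := well_founded_total T.
pose upto (a : T) : set T := [set x | ~ ltT a x].
pose A : set T := [set a | small_alphabet (upto a)].
have nsA : ~ small_alphabet A.
  move=> sA.
  have [a nAa amin] : exists2 a, ~ A a & forall b, ~ A b -> ~ ltT b a.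
    apply: (@well_founded_min T ltT (~` A)) => //.
    apply: contrapT => /set0P/negP/negPn/eqP A0.
    have [e eP] := sA (fun w => if w is inr g :: _ then g : nat -> nat else fun=> 0%N).
    have [|m] := eP [:: inr e]; last by rewrite ltnn.
    by move=> x _; apply: contrapT => nAx; have : set0 x by rewrite -A0.
  apply: nAa; apply: small_alphabet_sub (small_alphabet_setU1 a sA) => x /= nax.
  have [ax|->|xa] := totT a x; [by []|by left|right].
  by apply: contrapT => /amin.
have [a0 Aa0] : A !=set0.
  apply: contrapT => /set0P/negP/negPn/eqP A0; apply: nsA.
  by rewrite A0; exact: small_alphabet_set0.
have [phi phiP] : exists phi : seq (nat + T) -> nat -> nat,
    forall e : nat -> nat, exists2 w, word_over A w & forall m, (e m <= phi w m)%N.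
  have /existsNP[phi nphi] := nsA; exists phi => e.
  have /existsNP[w /not_implyP[wA nw]] :
      ~ forall w, word_over A w -> exists m, (phi w m < e m)%N.
    by move=> H; apply: nphi; exists e.
  by exists w => // m; rewrite leqNgt; apply/negP => H; apply: nw; exists m.
pose I : eqType := {classic {w | word_over A w}}.
have [ltI [wfI trI totI irrI]] := well_founded_total I.
pose wd (i : I) : seq (nat + T) := sval (i : {w | word_over A w}).
have wd_inj : injective wd.
  by move=> [w wP] [v vP] /= wv; exact: eq_exist.
have rkP (i : I) : exists a, [/\ A a, word_over (upto a) (wd i) &
    forall b, A b -> word_over (upto b) (wd i) -> ~ ltT b a].
  have [a [Aa ia] amin] : exists2 a, A a /\ word_over (upto a) (wd i) &
      forall b, A b /\ word_over (upto b) (wd i) -> ~ ltT b a.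
    apply: (@well_founded_min T ltT (fun a => A a /\ word_over (upto a) (wd i))) => //.
    case: i => w /=; rewrite /wd /=; elim: w => [|c w IH] cwA.
      by exists a0; split.
    have [|a [Aa wa]] := IH; first by move=> x xw; apply: cwA; rewrite inE xw orbT.
    case: c cwA => [n|x] cwA.
      by exists a; split=> // x; rewrite inE /=; exact: wa.
    have Ax : A x by apply: cwA; rewrite mem_head.
    have [ax|ax] := pselect (ltT a x).
      exists x; split=> // y; rewrite inE => /orP[/eqP[->]|yw]; first exact: irrT.
      by move=> xy; apply: (wa y yw); exact: trT ax xy.
    exists a; split=> // y; rewrite inE => /orP[/eqP[->]//|yw]; exact: wa yw.
  by exists a; split=> // b Ab ib; exact: amin.
have [rk rkA] := choice rkP.
pose lt (i j : I) := ltT (rk i) (rk j) \/ rk i = rk j /\ ltI i j.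
exists I, lt, (fun i => phi (wd i)); split.
- suff H a : forall i, rk i = a -> Acc lt i by move=> i; exact: H erefl.
  elim/(well_founded_ind wfT) : a => a IHa i.
  elim/(well_founded_ind wfI) : i => i IHi ia.
  constructor => j [ji|[ji lji]]; first by apply: IHa erefl; rewrite -ia.
  by apply: IHi lji _; rewrite ji.
- move=> i j k [ij|[ij lij]] [jk|[jk ljk]].
  + by left; exact: trT ij jk.
  + by left; rewrite -jk.
  + by left; rewrite ij.
  + by right; split; [rewrite ij|exact: trI lij ljk].
- move=> i j; have [ij|ij|ij] := totT (rk i) (rk j).
  + by apply: Or31; left.
  + have [lij|lij|lij] := totI i j; [apply: Or31|exact: Or32|apply: Or33]; by right.
  + by apply: Or33; left.
- by move=> e; have [w wA we] := phiP e; exists (exist _ w wA : I).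
- move=> i psi; have [Ai _ _] := rkA i.
  pose code (nl : nat * seq I) : seq (nat + T) :=
    inl nl.1 :: join_words [seq wd k | k <- nl.2].
  have code_inj : injective code.
    by move=> [n l] [n' l'] [-> /join_words_inj /(inj_map wd_inj) ->].
  have [e eP] := Ai (fun v => psi (xget (0%N, [::]) [set nl | code nl = v])).
  exists e => n l lP; have [|m] := eP (code (n, l)).
    move=> x; rewrite inE /=; apply: word_over_join => _ /mapP[k kl ->].
    have [_ kP _] := rkA k => y /kP nky iy.
    apply: nky; have [ki|[ki _]] := lP k kl; first exact: trT ki iy.
    by rewrite ki.
  case: xgetP => [nl _ /code_inj -> H|/(_ (n, l)) /(_ erefl) //].
  by exists m.
Qed.

(** * Sparse ultrafilters *)

(** Four elements, because sparseness is obtained from points of a fast growing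
    set lying between any two elements of [B]: the first two and the last two
    elements then enclose different points. *)
Definition sparse_set (g : nat -> nat) (B : set nat) : Prop :=
  forall b1 b2 b3 b4, B b1 -> B b2 -> B b3 -> B b4 ->
    (b1 < b2 < b3)%N -> (b3 < b4)%N -> (g b1 <= b4)%N.

Definition sparse_ultrafilter (F : set_system nat) : Prop :=
  forall g : nat -> nat, {homo g : m n / (m <= n)%N} -> exists2 B, F B & sparse_set g B.

(** The intervals of [j] that meet [B], together with their neighbours: this
    contains the preimage of the image of [B] under both halvings of [j]. *)
Definition saturation (j : nat -> nat) (B : set nat) : set nat :=
  [set n | exists2 b, B b & (j n <= (j b).+1)%N && (j b <= (j n).+1)%N].

(** If the saturation of each [B] in [F] contained some [G l] from some [n] on,
    choose [B] sparse for a function [g]: four elements of [G l] beyond [m] that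
    are far apart in [j] lie near four elements of [B] beyond [m], so that a bound
    for the last of them, computed from [G l] alone, exceeds [g m]. These bounds
    would dominate every [g]. *)
Lemma escape_saturation (L : Type) (G : L -> set nat) (P : set L)
    (F : set_system nat) (j : nat -> nat) :
  sparse_ultrafilter F -> {homo j : m n / (m <= n)%N} ->
  (forall N, exists M, forall n, (j n <= N)%N -> (n <= M)%N) ->
  (forall l, P l -> unbounded_set (G l)) ->
  (forall phi : nat * L -> nat -> nat, exists e : nat -> nat,
     forall n l, P l -> exists m, (phi (n, l) m < e m)%N) ->
  exists2 B, F B & forall l, P l -> unbounded_set (G l `\` saturation j B).
Proof.
move=> spF homj finj Gub nodom.
have lt_of a b : (j a < j b)%N -> (a < b)%N.
  by move=> ab; rewrite ltnNge; apply/negP => /homj; lia.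
have Gj (n : nat) l N : P l -> exists c, [/\ G l c, (n <= c)%N & (N < j c)%N].
  move=> Pl; have [M MP] := finj N.
  have [c Gc Mc] := Gub l Pl (n + M.+1)%N.
  exists c; split=> //; first lia.
  by rewrite ltnNge; apply/negP => /MP; lia.
have phiP (x : (nat * L) * nat) : exists N, P x.1.2 -> exists c1 c2 c3 c4,
    [/\ [/\ G x.1.2 c1, G x.1.2 c2, G x.1.2 c3 & G x.1.2 c4],
        [/\ x.1.1 <= c1, x.1.1 <= c2, x.1.1 <= c3 & x.1.1 <= c4]%N,
        [/\ (j x.2).+1 < j c1, (j c1).+2 < j c2, (j c2).+2 < j c3 & (j c3).+2 < j c4]%N &
        forall b, (j b <= (j c4).+1)%N -> (b <= N)%N].
  case: x => [[n l] m] /=; have [Pl|nPl] := pselect (P l); last by exists 0%N.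
  have [c1 [G1 n1 j1]] := Gj n l (j m).+1 Pl.
  have [c2 [G2 n2 j2]] := Gj n l (j c1).+2 Pl.
  have [c3 [G3 n3 j3]] := Gj n l (j c2).+2 Pl.
  have [c4 [G4 n4 j4]] := Gj n l (j c3).+2 Pl.
  by have [N NP] := finj (j c4).+1; exists N => _; exists c1, c2, c3, c4.
have [phi {}phiP] := choice phiP.
have [e eP] := nodom (fun nl m => phi (nl, m)).
have [g [homg _ eg]] := majorant e.
have [B FB spB] := spF g homg.
exists B => // l Pl N; apply: contrapT => noN.
have [m] := eP N l Pl; apply/negP; rewrite -leqNgt.
have [c1 [c2 [c3 [c4 [[G1 G2 G3 G4] [n1 n2 n3 n4] [j1 j2 j3 j4] phi4]]]]] :=
  phiP ((N, l), m) Pl.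
move: G1 G2 G3 G4 n1 n2 n3 n4 j1 j2 j3 j4 phi4 => /=.
move=> G1 G2 G3 G4 n1 n2 n3 n4 j1 j2 j3 j4 phi4.
have sat c : G l c -> (N <= c)%N -> saturation j B c.
  by move=> Gc Nc; apply: contrapT => nc; apply: noN; exists c.
have [b1 B1 /andP[b1l b1r]] := sat c1 G1 n1.
have [b2 B2 /andP[b2l b2r]] := sat c2 G2 n2.
have [b3 B3 /andP[b3l b3r]] := sat c3 G3 n3.
have [b4 B4 /andP[b4l b4r]] := sat c4 G4 n4.
have mb1 : (m < b1)%N by apply: lt_of; lia.
have b12 : (b1 < b2)%N by apply: lt_of; lia.
have b23 : (b2 < b3)%N by apply: lt_of; lia.
have b34 : (b3 < b4)%N by apply: lt_of; lia.
have gb : (g b1 <= b4)%N by apply: (spB b1 b2 b3 b4) => //; rewrite b12.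
have := eg m; have := homg _ _ (ltnW mb1); have := phi4 _ b4r.
lia.
Qed.

(** Recursion along [lt] where the value at [i] is any element of a set
    determined by the earlier values. *)
Lemma well_founded_choice (I Y : Type) (lt : I -> I -> Prop) (y0 : Y)
    (step : I -> (I -> Y) -> set Y) :
  well_founded lt ->
  (forall i b b', (forall k, lt k i -> b k = b' k) -> step i b = step i b') ->
  (forall i b, (forall k, lt k i -> step k b (b k)) -> step i b !=set0) ->
  exists b, forall i, step i b (b i).
Proof.
move=> wf ext ne.
have chooseP (s : set Y) : exists y, s !=set0 -> s y.
  by have [[y sy]|ns] := pselect (s !=set0); [exists y|exists y0].
have [pick pickP] := choice chooseP.
pose total i (rec : forall k, lt k i -> Y) k :=
  if pselect (lt k i) is left ki then rec k ki else y0.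
pose b := Fix wf (fun=> Y) (fun i rec => pick (step i (total i rec))).
have bE i : b i = pick (step i b).
  rewrite /b Fix_eq; last first.
    move=> x f f' ff'; congr (pick (step x _)); apply/funext => k.
    by rewrite /total; case: pselect.
  congr pick; apply: ext => k ki.
  by rewrite /total; case: pselect.
exists b => i; elim/(well_founded_ind wf) : i => i IH.
by rewrite bE; apply: pickP; apply: ne => k /IH.
Qed.

Lemma sparse_ultrafilter_not_cohere (F : set_system nat) :
  UltraFilter F -> sparse_ultrafilter F ->
  exists2 E, nonprincipal_ultrafilter E & ~ nearly_cohere E F.
Proof.
move=> uF spF.
have [I [lt [g [wf tr tot dom noseg]]]] := dominating_scale.
have [j jP] := choice (fun i => interval_partition (g i)).
(* [b i] is the member of [F] used at stage [i]; [rest b l] is what the stages in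
   [l] leave for [E]. *)
pose rest (b : I -> set nat) (l : seq I) : set nat :=
  [set n | forall k, k \in l -> ~ saturation (j k) (b k) n].
pose below i : set (seq I) := [set l | forall k, k \in l -> lt k i].
pose step i b : set (set nat) := [set B | F B /\
  forall l, below i l -> unbounded_set (rest b l `\` saturation (j i) B)].
have restub b l : (forall k, k \in l -> step k b (b k)) -> unbounded_set (rest b l).
  case: l => [|x l] stepb; first by move=> N; exists N.
  have [k kl kmax] := seq_last_lt x l tr tot.
  have [_ kub] := stepb k kl.
  have lk : below k [seq k' <- x :: l | k' != k].
    by move=> k'; rewrite mem_filter => /andP[/eqP k'k k'l]; exact: kmax.
  move=> N; have [n [nl' nk] Nn] := kub _ lk N.
  exists n => // k' k'l; have [->//|k'k] := eqVneq k' k.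
  by apply: nl'; rewrite mem_filter k'k.
have [b bP] : exists b, forall i, step i b (b i).
  apply: (well_founded_choice set0 wf).
    move=> i b b' bb'.
    have E l : below i l -> rest b l = rest b' l.
      by move=> li; apply/seteqP; split=> n nP k kl; have := nP k kl;
        rewrite bb' //; exact: li.
    by apply/seteqP; split=> B [FB BP]; split=> // l li; [rewrite -E//|rewrite E//];
      exact: BP.
  move=> i b bP; have [homj finj _] := jP i.
  have [B FB BP] := @escape_saturation _ (rest b) (below i) F (j i) spF homj finj
    (fun l li => restub b l (fun k kl => bP k (li k kl))) (noseg i).
  by exists B.
pose base : set_system nat :=
  [set S | exists l N, rest b l `&` [set n | (N <= n)%N] `<=` S].
have base_proper : ProperFilter base.
  split.
    move=> [l [N lN]].
    have [n ln Nn] := restub b l (fun k _ => bP k) N.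
    exact: (lN n).
  split; first by exists [::], 0%N.
    move=> S S' [l [N lN]] [l' [N' lN']].
    exists (l ++ l'), (maxn N N') => n [nl /=]; rewrite geq_max => /andP[Nn N'n].
    split; [apply: lN|apply: lN']; split=> // k kl; apply: nl; by rewrite mem_cat kl ?orbT.
  by move=> S S' SS' [l [N lN]]; exists l, N => n /lN /SS'.
have [E [uE bE]] := ultraFilterLemma base_proper.
have Etail N : E [set n | (N <= n)%N] by apply: bE; exists [::], N => n [].
exists E; first exact: tail_nonprincipal.
move=> /(nearly_cohere_halves uE uF)[e eP].
have [i ei] := dom e.
have [_ _ jstep] := jP i.
have {}jstep n m : (m <= e n)%N -> (j i m <= (j i n).+1)%N.
  by move=> me; apply: jstep; exact: leq_trans me (ei n).
have Esat : E (~` saturation (j i) (b i)).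
  by apply: bE; exists [:: i], 0%N => n [ni _]; apply: ni; rewrite mem_head.
have [Fb _] := bP i.
have absurd h : (forall n m, h n = h m -> (j i n <= (j i m).+1)%N) ->
    fmap h E <> fmap h F.
  move=> hj hE.
  have Fh : F (h @^-1` (h @` b i)) by apply: filterS Fb => n bn; exists n.
  have {Fh}Eh : fmap h E (h @` b i) by rewrite hE.
  have [n [[m bm mn] ns]] := filter_ex (@filterI _ E _ (h @^-1` (h @` b i)) _ Eh Esat).
  apply: ns; exists m => //; by rewrite !hj.
by case: (eP (j i) jstep); apply: absurd => n m;
  rewrite ?uphalf_half; move: (j i n) (j i m) => u v; lia.
Qed.

(** * Functions on the Stone-Cech compactification *)

Local Open Scope ring_scope.

Lemma nbhs_lt (R : realType) (T : topologicalType) (f : T -> R) t c :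
  continuous f -> f t < c -> nbhs t [set s | f s < c].
Proof.
move=> cf ft; exact: (cf t [set r | r < c] (open_nbhs_nbhs (conj (@open_lt R c) ft))).
Qed.

Lemma nbhs_gt (R : realType) (T : topologicalType) (f : T -> R) t c :
  continuous f -> c < f t -> nbhs t [set s | c < f s].
Proof.
move=> cf ft; exact: (cf t [set r | c < r] (open_nbhs_nbhs (conj (@open_gt R c) ft))).
Qed.

Lemma nbhs_neq0 (R : realType) (T : topologicalType) (f : T -> R) t :
  continuous f -> f t != 0 -> nbhs t [set s | f s != 0].
Proof.
move=> cf; rewrite neq_lt => /orP[/(nbhs_lt cf)|/(nbhs_gt cf)];
  apply: filterS => s /= fs; by rewrite neq_lt fs ?orbT.
Qed.

Lemma stone_cech_real_extension (R : realType) (X : topologicalType) (f : X -> R) :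
  continuous f -> (forall t, 0 <= f t <= 1) ->
  exists2 F : stone_cech R X -> R, continuous F &
    forall t, F (stone_cech_embed R t) = f t.
Proof.
move=> cf f01.
have fu : f \in @unit_functions R X.
  rewrite inE; split=> // _ [t _ <-]; by rewrite /= in_itv /= f01.
exists (fun b => (set_val b : cube R X) (SigSub fu)) => // b.
apply: (@continuous_comp _ _ _ set_val (fun p : cube R X => p (SigSub fu))).
  exact: initial_continuous.
exact: cube_proj_continuous.
Qed.

(** Any point of the compactification is the limit of an ultrafilter on the
    space, by density. *)
Lemma stone_cech_ultrafilter (R : realType) (X : topologicalType)
    (b : stone_cech R X) :
  exists2 P : set_system X, UltraFilter P &
    forall U, nbhs b U -> P (stone_cech_embed R @^-1` U).
Proof.
pose F : set_system X := filter_from (nbhs b) (fun U => stone_cech_embed R @^-1` U).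
have pF : ProperFilter F.
  apply: filter_from_proper; last first.
    move=> U; rewrite nbhsE => -[V [oV Vb] VU].
    have [y [Vy [t _ ty]]] := @stone_cech_embed_dense R X V (ex_intro _ b Vb) oV.
    by exists t; apply: VU; rewrite /= ty.
  apply: filter_from_filter; first by exists setT; exact: filterT.
  move=> U V bU bV; exists (U `&` V) => //; exact: filterI.
have [P [uP FP]] := ultraFilterLemma pF.
by exists P => // U bU; apply: FP; exists U.
Qed.

Lemma stone_cech_eq_on_embed (R : realType) (X : topologicalType)
    (F G : stone_cech R X -> R) :
  continuous F -> continuous G ->
  (forall t, F (stone_cech_embed R t) = G (stone_cech_embed R t)) -> F =1 G.
Proof.
move=> cF cG FG b; apply: subr0_eq; apply/eqP/negPn/negP => nFG.
have cD : continuous (fun b => F b - G b).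
  by move=> c; exact: (cvgB (cF c) (cG c)).
have [P uP PU] := stone_cech_ultrafilter b.
have /PU PD := nbhs_neq0 cD nFG.
by have [t /=] := filter_ex PD; rewrite FG subrr eqxx.
Qed.

(** * The half-line *)

(** The absolute value makes this a continuous retraction defined on all reals. *)
Definition half_line_point (R : realType) (r : R) : half_line R :=
  exist _ `|r| (mem_set (normr_ge0 r)).

Lemma half_line_pointE (R : realType) (r : R) :
  0 <= r -> set_val (half_line_point r) = r.
Proof. exact: ger0_norm. Qed.

Lemma half_line_point_continuous (R : realType) :
  continuous (@half_line_point R).
Proof.
move=> r U [_ [[B oB <-] /= Br BU]].
have nB := @norm_continuous _ R^o r B (open_nbhs_nbhs (conj oB Br)).
by apply: (@filterS _ (nbhs r) _ _ _ _ nB) => s Bs; exact: BU.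
Qed.

Lemma half_line_point_val (R : realType) (t : half_line R) :
  half_line_point (set_val t) = t.
Proof. by apply: val_inj => /=; apply: ger0_norm; exact: (set_valP t). Qed.

Lemma half_line_val_continuous (R : realType) :
  continuous (set_val : half_line R -> R).
Proof. exact: initial_continuous. Qed.

(** Cutting [v] to [S] keeps it continuous when the boundary of [S] consists of
    zeros of [v]; here [S] is a union of intervals between the points [z m], which
    are locally finite. *)
Lemma continuous_cut (R : realType) (X : topologicalType) (pos v : X -> R)
    (E : set nat) (z : nat -> X) (S : set X) :
  continuous pos -> injective pos -> continuous v -> (forall m, E m -> v (z m) = 0) ->
  (forall c : R, exists N, forall m, E m -> pos (z m) <= c -> (m <= N)%N) ->
  (forall s t, (forall m, E m ->
     (pos (z m) <= pos s) = (pos (z m) <= pos t)) -> S s -> S t) ->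
  continuous (fun t => if `[< S t >] then v t else 0).
Proof.
move=> cpos ipos cv vz zlf SE t.
have [[m [Em mt]]|nz] := pselect (exists m, E m /\ z m = t).
  have vt : v t = 0 by rewrite -mt vz.
  apply/cvgrPdist_lt => eps eps0.
  have /cvgrPdist_lt /(_ eps eps0) := cv t.
  rewrite vt if_same; apply: filterS => s.
  by case: asboolP => // _; rewrite subrr normr0.
have nearE N : \forall s \near t, forall m, (m <= N)%N -> E m ->
    (pos (z m) <= pos s) = (pos (z m) <= pos t).
  suff step m : E m -> \forall s \near t,
      (pos (z m) <= pos s) = (pos (z m) <= pos t).
    elim: N => [|N IH].
      have [E0|nE0] := pselect (E 0%N).
        by apply: filterS (step _ E0) => s H m; rewrite leqn0 => /eqP ->.
      by apply: filterS filterT => s _ m; rewrite leqn0 => /eqP ->.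
    have [EN|nEN] := pselect (E N.+1).
      apply: filterS (filterI IH (step _ EN)) => s [sN sE] m.
      by rewrite leq_eqVlt => /orP[/eqP ->|] //; exact: sN.
    apply: filterS IH => s sN m.
    by rewrite leq_eqVlt => /orP[/eqP ->|] //; exact: sN.
  move=> Em.
  have : pos (z m) != pos t.
    by apply/eqP => /ipos zt; apply: nz; exists m.
  rewrite neq_lt => /orP[zt|tz].
    have := nbhs_gt cpos zt.
    by apply: filterS => s /= zs; rewrite (ltW zs) (ltW zt).
  have := nbhs_lt cpos tz.
  by apply: filterS => s /= sz; rewrite !leNgt sz tz.
have [N NP] := zlf (pos t + 1).
have near1 : \forall s \near t, pos s < pos t + 1.
  by apply: (nbhs_lt cpos); rewrite ltrDl.
have same : \forall s \near t, `[< S s >] = `[< S t >].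
  apply: filterS (filterI (nearE N) near1) => s [sN s1].
  have st m : E m -> (pos (z m) <= pos s) = (pos (z m) <= pos t).
    move=> Em; have [mN|Nm] := leqP m N; first exact: sN.
    have far : ~~ (pos (z m) <= pos t + 1).
      by apply/negP => /(NP m Em); rewrite leqNgt Nm.
    rewrite -ltNge in far.
    by rewrite !leNgt (lt_trans s1 far) (lt_trans _ far)// ltrDl.
  by apply/asboolP/asboolP; apply: SE => m Em; rewrite st.
rewrite /continuous_at /=; case St : `[< S t >].
  have e : \forall s \near t, v s = (if `[< S s >] then v s else 0).
    by apply: filterS same => s ->; rewrite St.
  exact: cvg_trans (near_eq_cvg e) (cv t).
have e : \forall s \near t, (if `[< S s >] then v s else 0) = 0.
  by apply: filterS same => s ->; rewrite St.
exact: cvg_near_cst e.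
Qed.

Lemma continuous_max0 (R : realType) (T : topologicalType) (f : T -> R) :
  continuous f -> continuous (fun t => Num.max 0 (f t)).
Proof.
move=> cf t; have c0 : {for t, continuous (cst 0 : T -> R)} by exact: cvg_cst.
exact: (continuous_max c0 (cf t)).
Qed.

Lemma continuous_min1 (R : realType) (T : topologicalType) (f : T -> R) :
  continuous f -> continuous (fun t => Num.min 1 (f t)).
Proof.
move=> cf t; have c1 : {for t, continuous (cst 1 : T -> R)} by exact: cvg_cst.
exact: (continuous_min c1 (cf t)).
Qed.

(** * Points of the remainder *)

Definition past (R : realType) (c : R) : set (half_line R) :=
  [set t | c <= set_val t].

(** The initial segment [0, c] is compact, so its image is closed and a
    neighbourhood of [p] avoids it. *)
Lemma remainder_escapes (R : realType) (p : half_line_remainder R) U c :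
  (forall V, nbhs (set_val p : stone_cech R (half_line R)) V ->
     U (stone_cech_embed R @^-1` V)) ->
  UltraFilter U -> U (past c).
Proof.
move=> pU uU.
pose e := fun r : R => stone_cech_embed R (half_line_point r).
have ce : continuous e.
  move=> r; apply: continuous_comp; first exact: half_line_point_continuous.
  exact: stone_cech_embed_continuous.
have cK : compact (e @` `[0, c]).
  apply: continuous_compact; last exact: segment_compact.
  exact: continuous_subspaceT.
have nK : nbhs (set_val p : stone_cech R (half_line R)) (~` (e @` `[0, c])).
  apply: open_nbhs_nbhs; split.
    exact: closed_openC (compact_closed (@stone_cech_hausdorff R (half_line R)) cK).
  move=> [r _ rp]; apply: (set_valP p); exists (half_line_point r) => //.
apply: filterS (pU _ nK) => t /= tK; rewrite /past /= leNgt; apply/negP => tc.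
apply: tK; exists (set_val t); last by rewrite /e half_line_point_val.
by rewrite /= in_itv /= (ltW tc) andbT; exact: (set_valP t).
Qed.

(** A cluster point of [A] at infinity; it is not in the half-line because the
    function [min 1 (max 0 (t - t0))], extended, separates it from any [t0]. *)
Lemma remainder_limit_point (R : realType) (A : set (half_line R))
    (U : set (stone_cech R (half_line R))) :
  (forall c : R, A `&` past c !=set0) -> closed U ->
  (forall t, A t -> U (stone_cech_embed R t)) ->
  exists q : half_line_remainder R, U (set_val q).
Proof.
move=> Aub clU AU.
pose F : set_system (half_line R) := filter_from setT (fun c : R => A `&` past c).
have pF : ProperFilter F.
  apply: filter_from_proper; last by move=> c _; exact: Aub.
  apply: filter_from_filter; first by exists 0.
  move=> c d _ _; exists (Num.max c d) => // t [At].
  by rewrite /past /= ge_max => /andP[].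
have [|q [_ qF]] := @stone_cech_compact R (half_line R)
  (fmap (@stone_cech_embed R (half_line R)) F) _; first exact: filterT.
have nq : (~` range (@stone_cech_embed R (half_line R))) q.
  move=> [t0 _ t0q].
  have ct : continuous (fun t : half_line R => Num.min 1 (Num.max 0 (set_val t - set_val t0 : R))).
    have cB : continuous (fun t : half_line R => set_val t - set_val t0 : R).
      by move=> t; exact: (cvgB (@half_line_val_continuous R t) (cvg_cst _)).
    exact: continuous_min1 (continuous_max0 cB).
  have [|e ce eE] := stone_cech_real_extension ct.
    by move=> t; rewrite le_min ler01 le_max lexx /= ge_min lexx.
  have eq0 : e q < 1 by rewrite -t0q eE subrr maxxx min_r ?ltr01 ?ler01.
  have Fe : fmap (@stone_cech_embed R (half_line R)) F [set b | 1 <= e b].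
    exists (set_val t0 + 1) => // t [_ /= tt0]; rewrite /= eE.
    by rewrite le_min lexx le_max lerBrDl tt0 orbT.
  have [b [/= eb1 eb]] := qF _ _ Fe (nbhs_lt ce eq0).
  by move: eb; rewrite ltNge eb1.
exists (exist _ q (mem_set nq)); apply: clU => V qV.
have FU : fmap (@stone_cech_embed R (half_line R)) F U.
  by exists 0 => // t [/AU].
exact: qF _ _ FU qV.
Qed.

(** * Continua missing a point *)

(** Take [h] continuous with [h p = 0] and [h = 1] on [K]. For F-many [n] there
    is a gap [z n] of index [n] with [h (z n) < 1/3]. The function
    [max 0 (h - 1/3)] vanishes at the gaps, so it can be cut to any union of blocks
    between gaps; the cut function [u] extends continuously and takes only the
    values 0 and 2/3 on [K], hence is constant there. Let [B] be the set of the
    indices whose block meets [O]. If [B] were not large, cutting to the blocks of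
    the other indices would make [u] equal to 2/3 at [x], hence at [q], although
    these blocks avoid [O]. *)
Lemma continuum_gaps (R : realType) (p x q : half_line_remainder R)
    (K : set (half_line_remainder R)) (P X : set_system (half_line R))
    (idx : half_line R -> nat) (O : set (stone_cech R (half_line R))) :
  compact K -> connected K -> K x -> K q -> ~ K p ->
  UltraFilter P -> UltraFilter X ->
  (forall V, nbhs (set_val p : stone_cech R (half_line R)) V ->
     P (stone_cech_embed R @^-1` V)) ->
  (forall V, nbhs (set_val x : stone_cech R (half_line R)) V ->
     X (stone_cech_embed R @^-1` V)) ->
  (forall s t, (set_val s : R) <= set_val t -> (idx s <= idx t)%N) ->
  fmap idx P = fmap idx X ->
  nbhs (set_val q : stone_cech R (half_line R)) O ->
  exists2 B, fmap idx P B & forall m n, B m -> B n -> (m < n)%N ->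
    exists2 t, O (stone_cech_embed R t) & (m <= idx t <= n)%N.
Proof.
move=> cK nK Kx Kq nKp uP uX Pp Xx idx_le PX qO.
pose bH : topologicalType := stone_cech R (half_line R).
pose K' : set bH := set_val @` K.
have cval : continuous (set_val : half_line_remainder R -> bH).
  exact: initial_continuous.
have cK' : compact K' by apply: continuous_compact cK; exact: continuous_subspaceT.
have nK' : connected K'.
  by apply: connected_continuous_connected nK _; exact: continuous_subspaceT.
have nK'p : ~ K' (set_val p) by move=> [y Ky /val_inj yp]; apply: nKp; rewrite -yp.
have [h [ch h01 hp hK]] : exists h : bH -> R, [/\ continuous h, range h `<=` `[0, 1],
    h @` [set set_val p] `<=` [set 0] & h @` K' `<=` [set 1]].
  apply/uniform_separatorP.
  have crb : completely_regular_space bH.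
    apply: (@normal_completely_regular R).
      exact: compact_normal (@stone_cech_hausdorff R _) (@stone_cech_compact R _).
    exact/hausdorff_accessible/stone_cech_hausdorff.
  apply: crb => //.
  exact: compact_closed (@stone_cech_hausdorff R _) cK'.
have {}hp : h (set_val p) = 0 by apply: hp; exists (set_val p).
have {}hK b : K' b -> h b = 1 by move=> Kb; apply: hK; exists b.
have {}h01 b : 0 <= h b <= 1 by have := h01 (h b) (imageT _ b); rewrite /= in_itv.
pose low : set (half_line R) := [set t | h (stone_cech_embed R t) < 3^-1].
have Plow : P low by apply: (Pp [set b | h b < 3^-1]); apply: nbhs_lt => //; rewrite hp; lra.
pose E : set nat := idx @` low.
have PE : P (idx @^-1` E) by apply: filterS Plow => t lt; exists t.
have XE : X (idx @^-1` E) by have : fmap idx X E by rewrite -PX.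
have zP n : exists z, E n -> idx z = n /\ low z.
  have [[z lz zn]|nE] := pselect (E n); first by exists z.
  by exists (half_line_point 0).
have [z {}zP] := choice zP.
(* [same s t] says that no gap separates [s] from [t]. *)
pose same (s t : half_line R) := forall m, E m ->
  ((set_val (z m) : R) <= set_val s) = ((set_val (z m) : R) <= set_val t).
pose side (b : bool) : set (half_line R) :=
  [set t | E (idx t) /\ ((set_val (z (idx t)) : R) <= set_val t) = b].
(* A point in an interval with a gap may lie on either side of the gap; [X]
   decides. *)
have [b Xb] : exists b, X (side b).
  have [Xt|Xf] := in_ultra_setVsetC (side true) uX; first by exists true.
  exists false; apply: filterS (filterI XE Xf) => t [Et nt]; split=> //.
  by apply/negP => zt; apply: nt.
pose B : set nat := [set n | exists s t,
  [/\ side b s, idx s = n, O (stone_cech_embed R t) & same s t]].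
exists B; last first.
  move=> m n [s [t [[Es bs] sm Ot st]]] [s' [t' [[Es' bs'] sn Ot' st']]] mn.
  rewrite sm in Es bs; rewrite sn in Es' bs'.
  have [zm _] := zP m Es; have [zn _] := zP n Es'.
  have lt_of u v : (idx u < idx v)%N -> (set_val u : R) < set_val v.
    by move=> uv; rewrite ltNge; apply/negP => /idx_le; rewrite leqNgt uv.
  case: b {Xb B} bs bs' => bs bs'.
    exists t => //; rewrite -{1}zm -{1}zn !idx_le //; last by rewrite -st.
    by apply: ltW; rewrite ltNge -st // -ltNge; apply: lt_of; rewrite sm zn.
  exists t' => //; rewrite -{1}zm -{1}zn !idx_le //.
    by apply: ltW; rewrite ltNge -st' // bs'.
  by rewrite -st' //; apply/ltW/lt_of; rewrite zm sn.
have [//|PnB] := in_ultra_setVsetC B (fmap_ultra idx uP).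
exfalso.
have XnB : X (idx @^-1` ~` B) by have : fmap idx X (~` B) by rewrite -PX.
pose S : set (half_line R) :=
  [set t | exists s, [/\ side b s, ~ B (idx s) & same s t]].
pose w (c : bH) : R := Num.max 0 (h c - 3^-1).
have cw : continuous w.
  apply: continuous_max0 => c; exact: (cvgB (ch c) (cvg_cst _)).
pose v (t : half_line R) : R := w (stone_cech_embed R t).
have cv : continuous v.
  by move=> t; exact: (continuous_comp (@stone_cech_embed_continuous R _ t) (cw _)).
have vz m : E m -> v (z m) = 0.
  by move=> /zP[_ /= lz]; rewrite /v /w max_l // subr_le0 ltW.
have w01 c : 0 <= w c <= 1.
  have := h01 c; rewrite /w le_max lexx /= ge_max ler01 /=; lra.
pose u (t : half_line R) : R := if `[< S t >] then v t else 0.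
have cu : continuous u.
  apply: (continuous_cut (@half_line_val_continuous R) (@val_inj _ _ _) cv vz).
    move=> c; exists (idx (half_line_point c)) => m Em zc.
    have [zm _] := zP m Em; rewrite -zm; apply: idx_le.
    by apply: le_trans zc _; exact: ler_norm.
  move=> s t st [s0 [s0b nB s0s]]; exists s0; split=> // m Em.
  by rewrite s0s // st.
have [|U cU UE] := stone_cech_real_extension cu.
  by move=> t; rewrite /u; case: ifP => _; [exact: w01|rewrite lexx ler01].
(* [U] is everywhere 0 or [w], a closed relation checked on the half-line. *)
have Uw c : U c * (w c - U c) = 0.
  pose D := fun c => U c * (w c - U c).
  have cD : continuous D.
    move=> a; exact: (cvgM (cU a) (cvgB (cw a) (cU a))).
  apply: (@stone_cech_eq_on_embed R (half_line R) D (cst 0) cD (@cst_continuous _ _ 0)).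
  move=> t; rewrite /D UE /u /v; case: ifP => _; first by rewrite subrr mulr0.
  by rewrite mul0r.
have wK c : K' c -> w c = 2 / 3.
  by move=> /hK hc; rewrite /w hc max_r; lra.
have Ux : U (set_val x) = 2 / 3.
  rewrite -(wK (set_val x)); last by exists x.
  apply/eqP; rewrite -subr_eq0; apply/negPn/negP => Uxw.
  have cD : continuous (fun c => U c - w c).
    by move=> a; exact: (cvgB (cU a) (cw a)).
  have [t [[bt nBt] /=]] :=
    filter_ex (filterI (filterI Xb XnB) (Xx _ (nbhs_neq0 cD Uxw))).
  rewrite UE /u asboolT ?subrr ?eqxx //.
  by exists t.
have Uq : 0 < U (set_val q).
  have Uq01 : U (set_val q) = 0 \/ U (set_val q) = 2 / 3.
    have /eqP := Uw (set_val q); rewrite mulf_eq0 => /orP[/eqP ->|]; first by left.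
    by rewrite subr_eq0 => /eqP <-; right; apply: wK; exists q.
  case: Uq01 => [Uq0|->]; last by lra.
  have cUK : connected (U @` K').
    by apply: connected_continuous_connected nK' _; exact: continuous_subspaceT.
  have Kq' : (U @` K') 0 by exists (set_val q) => //; exists q.
  have Kx' : (U @` K') (2 / 3) by exists (set_val x) => //; exists x.
  have [|c Kc Uc] := (connected_intervalP (U @` K')).1 cUK _ _ Kq' Kx' 3^-1; first lra.
  have := Uw c; rewrite Uc wK // => /eqP; rewrite mulf_eq0 => /orP[]/eqP; lra.
have [y [[Oy Uy] [t _ ty]]] : (O `&` [set c | 0 < U c]) `&`
    range (@stone_cech_embed R (half_line R)) !=set0.
  have : nbhs (set_val q : bH) (O `&` [set c | 0 < U c]).
    exact: filterI qO (nbhs_gt cU Uq).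
  rewrite nbhsE => -[V [oV Vq] VO].
  have [y [Vy ry]] := @stone_cech_embed_dense R (half_line R) V (ex_intro _ _ Vq) oV.
  by exists y; split=> //; exact: VO.
rewrite -ty in Oy Uy; move: Uy; rewrite /= UE /u.
case: asboolP => [[s [sb nBs st]] _|]; last by rewrite ltxx.
by apply: nBs; exists s, t.
Qed.

(** * Dense continuum components *)

Lemma sin_nat_pi (R : realType) (n : nat) : sin (pi * n%:R : R) = 0.
Proof.
elim: n => [|n IH]; first by rewrite mulr0 sin0.
by rewrite -natr1 mulrDr mulr1 sinDpi IH oppr0.
Qed.

(** The arches of [|sin (pi t)|] above the intervals [n, n + 1] with [n] in [W]. *)
Lemma bump_sequence (R : realType) (W : set nat) :
  exists2 f : half_line R -> R, continuous f &
    [/\ forall t, 0 <= f t <= 1, forall t, 0 < f t -> W (Num.truncn (set_val t : R)) &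
        forall n, W n -> f (half_line_point (n%:R + 2^-1)) = 1].
Proof.
pose v (t : half_line R) : R := `|sin (pi * set_val t)|.
pose S : set (half_line R) := [set t | W (Num.truncn (set_val t : R))].
have cv : continuous v.
  have cs : continuous (fun r : R => `|sin (pi * r)|).
    move=> r; apply: cvg_norm.
    apply: (@continuous_comp _ _ _ (fun r : R => pi * r) sin); last exact: continuous_sin.
    exact: (cvgM (cvg_cst _) cvg_id).
  by move=> t; exact: (continuous_comp (@half_line_val_continuous R t) (cs _)).
have v0 n : setT n -> v (half_line_point n%:R) = 0.
  by move=> _; rewrite /v half_line_pointE // sin_nat_pi normr0.
exists (fun t => if `[< S t >] then v t else 0).
  apply: (continuous_cut (@half_line_val_continuous R) (@val_inj _ _ _) cv v0).
    move=> c; exists (Num.truncn `|c|) => m _; rewrite half_line_pointE // => mc.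
    by rewrite truncn_ge_nat // (le_trans mc) // ler_norm.
  move=> s t st; rewrite /S /=; congr W; apply/eqP; rewrite eqn_leq.
  have s0 : (0 : R) <= set_val s := set_valP s.
  have t0 : (0 : R) <= set_val t := set_valP t.
  rewrite !truncn_ge_nat //.
  have := st (Num.truncn (set_val s : R)) I; have := st (Num.truncn (set_val t : R)) I.
  rewrite !half_line_pointE // !truncn_le s0 t0 => -> <-; exact: isT.
split=> [t|t|n Wn].
- by case: asboolP => _; rewrite ?lexx ?ler01 // normr_ge0 sin_max.
- by case: asboolP => // _; rewrite ltxx.
have h0 : 0 <= n%:R + 2^-1 :> R by apply: addr_ge0; rewrite ?ler0n ?invr_ge0 ?ler0n.
have tn : Num.truncn (n%:R + 2^-1 : R) = n.
  apply: truncn_def; have := @natr1 R n; lra.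
rewrite asboolT; last by rewrite /S /= half_line_pointE // tn.
rewrite /v half_line_pointE // mulrDr sinDpihalf.
exact/sin0cos1/sin_nat_pi.
Qed.

(** Density provides, for each unbounded [W], a continuum inside [kappa x p] that
    reaches the bumps at [W]. By [continuum_gaps] a member of [F] then has points
    of [W] between its elements; [W] is chosen to outgrow [g]. *)
Lemma dense_kappa_sparse (R : realType) (p x : half_line_remainder R)
    (P X : set_system (half_line R)) (h : nat -> nat) :
  dense (kappa x p) ->
  UltraFilter P -> UltraFilter X ->
  (forall V, nbhs (set_val p : stone_cech R (half_line R)) V ->
     P (stone_cech_embed R @^-1` V)) ->
  (forall V, nbhs (set_val x : stone_cech R (half_line R)) V ->
     X (stone_cech_embed R @^-1` V)) ->
  {homo h : m n / (m <= n)%N} ->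
  (forall N, exists M, forall n, (h n <= N)%N -> (n <= M)%N) ->
  let idx := fun t : half_line R => h (Num.truncn (set_val t : R)) in
  fmap idx P = fmap idx X -> sparse_ultrafilter (fmap idx P).
Proof.
move=> dk uP uX Pp Xx homh finh idx PX g homg.
(* [W] is the orbit of 0 under a map whose steps outgrow [g], seen through [h]. *)
have nextP w : exists w', (w < w')%N /\ (g (h w) < h w')%N.
  have [M MP] := finh (g (h w)).
  exists (w + M).+1; split; first lia.
  by rewrite ltnNge; apply/negP => /MP; lia.
have [next {}nextP] := choice nextP.
pose W : set nat := range (fun k => iter k next 0%N).
have lt_iter : {homo (fun k => iter k next 0%N) : k l / (k < l)%N}.
  by apply: homo_ltn => [a b c|k]; [exact: ltn_trans|exact: (nextP _).1].
have Wub N : exists2 w, W w & (N <= w)%N.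
  exists (iter N next 0%N); first by exists N.
  by elim: N => // N IH; rewrite (leq_ltn_trans IH) // (nextP _).1.
have Wnext w w' : W w -> W w' -> (w < w')%N -> (g (h w) < h w')%N.
  move=> [k _ <-] [l _ <-] kl.
  have {}kl : (k < l)%N.
    rewrite ltnNge leq_eqVlt; apply/negP => /orP[/eqP E|/lt_iter]; last by lia.
    by rewrite E ltnn in kl.
  apply: leq_trans (nextP _).2 _; apply: homh.
  by move: kl; rewrite leq_eqVlt => /orP[/eqP <- //|/lt_iter/ltnW].
have [bump cbump [bump01 bumpW bump1]] := bump_sequence R W.
have [Fb cF FE] := stone_cech_real_extension cbump bump01.
have [q0 Fq0] : exists q0 : half_line_remainder R, [set b | 1 <= Fb b] (set_val q0).
  apply: (@remainder_limit_point R [set half_line_point (w%:R + 2^-1) | w in W]).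
  - move=> c; have [w Ww cw] := Wub (Num.truncn `|c|).+1.
    exists (half_line_point (w%:R + 2^-1)); split; first by exists w.
    have w0 : (0 : R) <= w%:R + 2^-1 by rewrite addr_ge0 ?invr_ge0 ?ler0n.
    rewrite /past /= half_line_pointE //.
    have : `|c| < (Num.truncn `|c|).+1%:R by have /andP[] := truncn_itv (normr_ge0 c).
    have : (Num.truncn `|c|).+1%:R <= w%:R :> R by rewrite ler_nat.
    by have := ler_norm c; lra.
  - by apply: (preimage_closed (f := Fb) (D := [set r | 1 <= r])) => [b _|];
      [exact: cF|exact: closed_ge].
  - by move=> _ [w Ww <-]; rewrite /= FE bump1.
have cval : continuous (set_val : half_line_remainder R -> stone_cech R (half_line R)).
  exact: initial_continuous.
have oV : open [set y : half_line_remainder R | 0 < Fb (set_val y)].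
  rewrite openE => y /= Fy.
  exact: cval y _ (nbhs_gt cF Fy).
have [|q [/= Fq [C [Cx Cp sC] Cq]]] := dk _ _ oV.
  by exists q0; apply: lt_le_trans Fq0.
have [K [[cK nK _] KC Kx Kq]] := sC _ _ Cx Cq.
have nKp : ~ K p by move=> /KC /Cp; exact.
have idx_le s t : (set_val s : R) <= set_val t -> (idx s <= idx t)%N.
  by move=> st; apply: homh; exact: le_truncn.
have [B PB Bgap] := continuum_gaps cK nK Kx Kq nKp uP uX Pp Xx idx_le PX (nbhs_gt cF Fq).
exists B => // b1 b2 b3 b4 B1 B2 B3 B4 /andP[b12 b23] b34.
have [t /= ot /andP[b1t tb2]] := Bgap b1 b2 B1 B2 b12.
have [t' /= ot' /andP[b3t' t'b4]] := Bgap b3 b4 B3 B4 b34.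
rewrite FE in ot; rewrite FE in ot'.
have tt' : (idx t < idx t')%N by lia.
have ww' : (Num.truncn (set_val t : R) < Num.truncn (set_val t' : R))%N.
  by rewrite ltnNge; apply/negP => /homh; move: tt'; rewrite /idx; lia.
have := Wnext _ _ (bumpW _ ot) (bumpW _ ot') ww'.
have := homg _ _ b1t; rewrite -/(idx t) -/(idx t'); lia.
Qed.

Lemma kappa_not_dense (R : realType) (p x : half_line_remainder R) :
  near_coherence_of_filters -> ~ dense (kappa x p).
Proof.
move=> ncf dk.
have [P uP Pp] := stone_cech_ultrafilter (set_val p : stone_cech R (half_line R)).
have [X uX Xx] := stone_cech_ultrafilter (set_val x : stone_cech R (half_line R)).
pose fl (t : half_line R) := Num.truncn (set_val t : R).
have tail U : UltraFilter U -> (forall c, U (past c)) ->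
    forall N, fmap fl U [set n | (N <= n)%N].
  move=> uU Uc N; apply: (@filterS _ U _ _ _ _ (Uc N%:R)) => t /= tN.
  by rewrite truncn_ge_nat //; exact: (set_valP t).
have uflP := fmap_ultra fl uP; have uflX := fmap_ultra fl uX.
have Ptail := tail P uP (fun c => remainder_escapes c Pp uP).
have Xtail := tail X uX (fun c => remainder_escapes c Xx uX).
have [e eP] := nearly_cohere_halves uflP uflX
  (ncf _ _ (tail_nonprincipal uflP Ptail) (tail_nonprincipal uflX Xtail)).
have [j [homj finj jstep]] := interval_partition e.
have [h [homh finh hPX]] : exists h : nat -> nat, [/\ {homo h : m n / (m <= n)%N},
    forall N, exists M, forall n, (h n <= N)%N -> (n <= M)%N &
    fmap h (fmap fl P) = fmap h (fmap fl X)].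
  have [hPX|hPX] := eP j jstep.
    exists (fun n => (j n)./2); split=> // [m n /homj|N]; first lia.
    by have [M MP] := finj (N.*2.+1); exists M => n hn; apply: MP; lia.
  exists (fun n => uphalf (j n)); split=> // [m n /homj|N]; first by rewrite !uphalf_half; lia.
  have [M MP] := finj (N.*2.+1); exists M => n; rewrite uphalf_half => hn; apply: MP; lia.
pose F := fmap h (fmap fl P).
have uF : UltraFilter F by exact: fmap_ultra.
have spF : sparse_ultrafilter F.
  exact: (dense_kappa_sparse dk uP uX Pp Xx homh finh hPX).
have [E npE nEF] := sparse_ultrafilter_not_cohere uF spF.
apply/nEF/ncf => //; apply: tail_nonprincipal => // N.
have [M MP] := finh N.
apply: (@filterS _ P _ _ _ _ (Ptail M.+1)) => t /= Mt.
by rewrite leqNgt; apply/negP => /ltnW /MP; rewrite leqNgt Mt.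
Qed.

Theorem theorem4p8 (R : realType) :
  near_coherence_of_filters ->
  (forall x : half_line_remainder R, ~ coastal x) /\
  (forall p : half_line_remainder R, ~ non_block_point p).
Proof.
move=> ncf; split=> [x [p [_]]|p [x [_]]]; exact: kappa_not_dense.
Qed.
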